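(* Let $F$ be a planar face (of a tetrahedron in $\mathbb R^3$) with constant unit normal $\boldsymbol n$. For every sufficiently smooth vector field $\boldsymbol u$ with values in $\mathbb R^3$, setting $\boldsymbol\sigma=\operatorname{dev}\operatorname{def}\boldsymbol u$, one has on $F$ $$\operatorname{tr}_1^{\mathrm{cott}}(\boldsymbol\sigma)=\tfrac12\operatorname{def}_F(\boldsymbol u\times\boldsymbol n)-\tfrac12\operatorname{sym}\operatorname{curl}_F(\Pi_F\boldsymbol u).$$ Moreover, the two trace diagrams associated with $\boldsymbol u\xrightarrow{\operatorname{dev}\operatorname{def}}\boldsymbol\sigma\xrightarrow{\operatorname{cott}}\boldsymbol\tau$ commute, i.e. on $F$: (a) for every sufficiently smooth $\mathbb R^3$-valued $\boldsymbol u$, $$\operatorname{tr}_2^{\mathrm{cott}}(\operatorname{dev}\operatorname{def}\boldsymbol u)=-\operatorname{def}_F\operatorname{curl}_F(\boldsymbol u\cdot\boldsymbol n),\qquad \operatorname{tr}_3^{\mathrm{cott}}(\operatorname{dev}\operatorname{def}\boldsymbol u)=\tfrac12\operatorname{hess}_F\operatorname{div}_F(\boldsymbol u\times\boldsymbol n);$$ (b) for every sufficiently smooth symmetric traceless matrix field $\boldsymbol\sigma$, with $\boldsymbol\tau=\operatorname{cott}\boldsymbol\sigma$, $$\boldsymbol n\cdot\boldsymbol\tau\cdot\boldsymbol n=-\operatorname{div}_F\operatorname{div}_F\operatorname{tr}_2^{\mathrm{cott}}(\boldsymbol\sigma),\qquad \boldsymbol n\times\boldsymbol\tau\cdot\boldsymbol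 n=\operatorname{rot}_F\operatorname{tr}_3^{\mathrm{cott}}(\boldsymbol\sigma).$$
   Context: $\operatorname{sym}U=\frac12(U+U^T)$, $\operatorname{dev}U=U-\frac13\operatorname{Tr}(U)\mathbf I$, $\operatorname{def}\boldsymbol u=\operatorname{sym}\nabla\boldsymbol u$; $\operatorname{div}$ and $\operatorname{curl}$ act row-wise on matrix fields. $S(U)=U^T-\operatorname{Tr}(U)\mathbf I$ and $\operatorname{cott}U=\operatorname{curl}S^{-1}\operatorname{curl}S^{-1}\operatorname{curl}U$; for symmetric traceless $\boldsymbol\sigma$ it equals $\operatorname{curl}((\operatorname{curl}(\operatorname{sym}\operatorname{curl}\boldsymbol\sigma))^T)$. $\operatorname{mskw}(\boldsymbol a)$ is the matrix with $\operatorname{mskw}(\boldsymbol a)\boldsymbol b=\boldsymbol a\times\boldsymbol b$; $\boldsymbol a\times U=\operatorname{mskw}(\boldsymbol a)U$, $U\times\boldsymbol a=U\operatorname{mskw}(\boldsymbol a)$; $\boldsymbol a\cdot U\cdot\boldsymbol b=\boldsymbol a^TU\boldsymbol b$, and $\boldsymbol n\times\boldsymbol\tau\cdot\boldsymbol n=\boldsymbol n\times(\boldsymbol\tau\boldsymbol n)$. Surface operators: $\Pi_F=\mathbf I-\boldsymbol n\boldsymbol n^T$, $\nabla_F=\Pi_F\nabla$, $\nabla_F^\perp=\boldsymbol n\times\nabla$, $\partial_n=\boldsymbol n\cdot\nabla$. For a vector field $\boldsymbol a$: $\operatorname{def}_F\boldsymbol a=\frac12(\boldsymbol a\nabla_F^T+\nabla_F\boldsymbol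 a^T)$ where $(\boldsymbol a\nabla_F^T)_{ij}=(\nabla_F)_ja_i$; $(\operatorname{curl}_F\boldsymbol a)_{ij}=(\nabla_F^\perp)_ja_i$; for scalar $a$, $\operatorname{curl}_Fa=\nabla_F^\perp a$. $\operatorname{div}_F\boldsymbol a=\nabla_F\cdot\boldsymbol a$, $\operatorname{rot}_F\boldsymbol a=\nabla_F^\perp\cdot\boldsymbol a$, both acting row-wise on matrices; $\operatorname{hess}_Fa=\nabla_F\nabla_F^Ta$. Traces on $F$ of a symmetric traceless field $\boldsymbol\sigma$: $\operatorname{tr}_1^{\mathrm{cott}}(\boldsymbol\sigma)=\operatorname{sym}(\Pi_F\boldsymbol\sigma\times\boldsymbol n)$, $\operatorname{tr}_2^{\mathrm{cott}}(\boldsymbol\sigma)=\operatorname{sym}\big((2\operatorname{def}_F(\Pi_F\boldsymbol\sigma\boldsymbol n)-\Pi_F(\partial_n\boldsymbol\sigma)\Pi_F)\times\boldsymbol n\big)$, $\operatorname{tr}_3^{\mathrm{cott}}(\boldsymbol\sigma)=2\operatorname{def}_F(\Pi_F(\operatorname{sym}\operatorname{curl}\boldsymbol\sigma)\boldsymbol n)-\Pi_F\partial_n(\operatorname{sym}\operatorname{curl}\boldsymbol\sigma)\Pi_F$. *)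

(* Defs.v *)
From HB Require Import structures.
From mathcomp Require Import all_boot all_order all_algebra.
From mathcomp Require Import boolp classical_sets functions reals.
From mathcomp Require Import topology normedtype derive ring.

Set Implicit Arguments.
Unset Strict Implicit.
Unset Printing Implicit Defensive.
Import Order.TTheory GRing.Theory Num.Theory.
Import numFieldNormedType.Exports.
Local Open Scope classical_set_scope.
Local Open Scope ring_scope.

Section Algebra.
Context {R : realType}.
Implicit Types (a b n : 'cV[R]_3) (U : 'M[R]_3).

Definition dot a b : R := \sum_i a i 0 * b i 0.

(* Indices are added in 'I_3 = Z/3, so that 1 and 2 shift them cyclically. *)
Definition cross a b : 'cV[R]_3 :=
  \col_i (a (i + 1) 0 * b (i + 2%:R) 0 - a (i + 2%:R) 0 * b (i + 1) 0).

Definition mskw a : 'M[R]_3 := \matrix_(i, j) cross a (delta_mx j 0) i 0.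

Lemma mskwE a b : mskw a *m b = cross a b.
Proof.
apply/colP => i; rewrite !mxE.
under eq_bigr => j _ do rewrite !mxE !andbT mulrBl -!mulrA.
rewrite big_split sumrN -!mulr_sumr /=; congr (_ * _ - _ * _).
- rewrite (bigD1 (i + 2%:R)) //= eqxx mul1r big1 ?addr0 // => j ji.
  by rewrite eq_sym (negPf ji) mul0r.
- rewrite (bigD1 (i + 1)) //= eqxx mul1r big1 ?addr0 // => j ji.
  by rewrite eq_sym (negPf ji) mul0r.
Qed.

Definition sym U : 'M[R]_3 := 2^-1 *: (U + U^T).

Definition dev U : 'M[R]_3 := U - (3^-1 * \tr U)%:M.

Definition Smap U : 'M[R]_3 := U^T - (\tr U)%:M.

Definition Sinv U : 'M[R]_3 := U^T - (2^-1 * \tr U)%:M.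

Lemma SmapK : cancel Smap Sinv.
Proof.
move=> U; rewrite /Sinv /Smap !linearB /= trmxK tr_scalar_mx mxtrace_tr.
rewrite mxtrace_scalar; apply/matrixP => i j; rewrite !mxE.
by case: (i == j); rewrite ?mulr0n ?mulr1n; field.
Qed.

Lemma SinvK : cancel Sinv Smap.
Proof.
move=> U; rewrite /Sinv /Smap !linearB /= trmxK tr_scalar_mx mxtrace_tr.
rewrite mxtrace_scalar; apply/matrixP => i j; rewrite !mxE.
by case: (i == j); rewrite ?mulr0n ?mulr1n; field.
Qed.

Definition PiF n : 'M[R]_3 := 1%:M - n *m n^T.

End Algebra.

(* A field on R^3 is a total function; its values off the open set under
   consideration play no role.  Matrix fields are differentiated entrywise, and
   row-wise operators act on [row i] of a matrix field, transposed to a column. *)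
Section Fields.
Context {R : realType}.
Implicit Types (f : 'cV[R]_3 -> R) (a u : 'cV[R]_3 -> 'cV[R]_3).
Implicit Types (U sigma : 'cV[R]_3 -> 'M[R]_3) (n x : 'cV[R]_3).

Definition pd (i : 'I_3) f x : R := 'D_(delta_mx i 0 : 'cV[R]_3) f x.

Fixpoint Ck (k : nat) (Omega : set 'cV[R]_3) f : Prop :=
  (forall x, Omega x -> {for x, continuous f}) /\
  match k with
  | 0 => True
  | k'.+1 => forall i : 'I_3,
      (forall x, Omega x -> derivable f x (delta_mx i 0 : 'cV[R]_3)) /\
      Ck k' Omega (pd i f)
  end.

Definition Ckmx m p (k : nat) (Omega : set 'cV[R]_3)
    (g : 'cV[R]_3 -> 'M[R]_(m, p)) : Prop :=
  forall i j, Ck k Omega (fun y => g y i j).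

Definition grad f x : 'cV[R]_3 := \col_i pd i f x.

Definition vgrad u x : 'M[R]_3 := \matrix_(i, j) pd j (fun y => u y i 0) x.

Definition def u x : 'M[R]_3 := sym (vgrad u x).

Definition vcurl a x : 'cV[R]_3 :=
  \col_i (pd (i + 1) (fun y => a y (i + 2%:R) 0) x
          - pd (i + 2%:R) (fun y => a y (i + 1) 0) x).

Definition curl U x : 'M[R]_3 :=
  \matrix_(i, j) vcurl (fun y => (row i (U y))^T) x j 0.

Definition cott U : 'cV[R]_3 -> 'M[R]_3 :=
  curl (Sinv \o curl (Sinv \o curl U)).

Definition symcurl U x : 'M[R]_3 := sym (curl U x).

Definition devdef u x : 'M[R]_3 := dev (def u x).

Definition gradF n f x : 'cV[R]_3 := PiF n *m grad f x.

Definition gradFperp n f x : 'cV[R]_3 := cross n (grad f x).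

Definition dn n f x : R := dot n (grad f x).

Definition dnmx n U x : 'M[R]_3 := \matrix_(i, j) dn n (fun y => U y i j) x.

Definition vgradF n a x : 'M[R]_3 :=
  \matrix_(i, j) gradF n (fun y => a y i 0) x j 0.

Definition defF n a x : 'M[R]_3 := 2^-1 *: (vgradF n a x + (vgradF n a x)^T).

Definition curlF n f x : 'cV[R]_3 := gradFperp n f x.

Definition vcurlF n a x : 'M[R]_3 :=
  \matrix_(i, j) gradFperp n (fun y => a y i 0) x j 0.

Definition divF n a x : R := \sum_i gradF n (fun y => a y i 0) x i 0.

Definition rotF n a x : R := \sum_i gradFperp n (fun y => a y i 0) x i 0.

Definition mdivF n U x : 'cV[R]_3 := \col_i divF n (fun y => (row i (U y))^T) x.

Definition mrotF n U x : 'cV[R]_3 := \col_i rotF n (fun y => (row i (U y))^T) x.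

Definition hessF n f x : 'M[R]_3 :=
  \matrix_(i, j) gradF n (fun y => gradF n f y j 0) x i 0.

Definition tr1_cott n sigma x : 'M[R]_3 := sym (PiF n *m sigma x *m mskw n).

Definition tr2_cott n sigma x : 'M[R]_3 :=
  sym ((2 *: defF n (fun y => PiF n *m sigma y *m n) x
        - PiF n *m dnmx n sigma x *m PiF n) *m mskw n).

Definition tr3_cott n sigma x : 'M[R]_3 :=
  2 *: defF n (fun y => PiF n *m symcurl sigma y *m n) x
  - PiF n *m dnmx n (symcurl sigma) x *m PiF n.

End Fields.

Section Tetrahedron.
Context {R : realType}.
Implicit Types (v : 'I_4 -> 'cV[R]_3) (i : 'I_4) (n : 'cV[R]_3).

Definition tetrahedron v : Prop :=
  forall c : 'I_4 -> R,
    \sum_j c j = 0 -> \sum_j c j *: v j = 0 -> forall j, c j = 0.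

(* The closed face opposite to the vertex [v i]. *)
Definition face v i : set 'cV[R]_3 :=
  [set x | exists c : 'I_4 -> R,
     [/\ forall j, 0 <= c j, c i = 0, \sum_j c j = 1
       & x = \sum_j c j *: v j]].

(* Both orientations are allowed. *)
Definition unit_normal v i n : Prop :=
  dot n n = 1 /\
  forall j k : 'I_4, j != i -> k != i -> dot n (v j - v k) = 0.

End Tetrahedron.

(* Main.v *)
Require Import Defs.
From mathcomp Require Import all_boot all_order all_algebra.
From mathcomp Require Import boolp classical_sets functions reals.
From mathcomp Require Import topology normedtype derive ring lra.
Set Implicit Arguments.
Unset Strict Implicit.
Unset Printing Implicit Defensive.
Import Order.TTheory GRing.Theory Num.Theory.
Import numFieldNormedType.Exports.
Local Open Scope classical_set_scope.
Local Open Scope ring_scope.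

(** Both sides of every identity are differential operators with constant
coefficients, homogeneous of some order, applied to the same field.  Such an
operator of first order is [symop B : G |-> \sum_q B(e_q, d_q G)], where the bilinear
[B(xi, A)] is its symbol, the value at the origin that the operator takes on the
plane wave [exp(xi . x) A].  Composing two of them gives
[\sum_(q, r) B(e_q, B'(e_r, d_q d_r G))], and second derivatives commute
([clairaut]), so only the part of [B(xi, B'(eta, A))] that is symmetric in
[xi] and [eta] matters.  Hence two compositions agree on C^2 fields as soon as
their symmetrised symbols do ([second_order_symbol]), and the differential
identities become identities between vectors and matrices of R^3, such as
[a x (b x c) = (a . c) b - (a . b) c].

The third-order identities factor through ones of order at most two by means of
[T_n(S) = 2 def_F(Pi S n) - Pi (d_n S) Pi] ([sff]), for which
[tr_2(sigma) = sym(T_n(sigma) x n)] and [tr_3(sigma) = T_n(sym curl sigma)].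
Geometrically [T_n(S)] is, up to sign, twice the first variation of the second
fundamental form of the plane when the Euclidean metric is perturbed by [S].
Write [inc S] for [curl((curl S)^T)].  Two facts carry everything.
- [T_n(def u) = hess_F(u . n)] ([sff_def]): moving the metric by the
  infinitesimal flow of [u] bends the plane into the graph of [u . n].
- [n x (inc S) n = rot_F T_n(S)] for symmetric [S] ([linearized_codazzi]): the
  linearisation of the Codazzi equation.

For the first diagram, [sym curl dev def u = 1/2 def curl u] and
[n . curl u = div_F(u x n)] give [tr_3] at once.  In [tr_2] and [tr_1] the trace
removed by [dev] only contributes a multiple of [sym(mskw n) = 0]; for [tr_2]
this uses [Pi n = 0], that is [|n| = 1].

For the second diagram, [cott sigma = curl(S^-1 inc sigma)] when [sigma] is
symmetric.  The skew part of [curl sigma] contributes a gradient to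
[S^-1 inc sigma], which the outer [curl] kills, so that
[cott sigma = inc(sym curl sigma)]; the Codazzi identity at [sym curl sigma] is
then the tangential claim.  For the normal one,
[n . (curl Y) n = - div_F(n x Y^T n)] turns [n . (cott sigma) n] into
[- div_F(n x (inc sigma) n) = - div_F rot_F T_n(sigma)], and
[div_F div_F sym(T x n) = div_F rot_F T]. *)

(** * Symmetry of second derivatives *)

Section Clairaut.
Context {R : realType} {V : normedModType R}.
Implicit Types (f : V -> R) (a b x : V) (Omega : set V).

Lemma is_derive_line f a x (t : R) :
  derivable f (x + t *: a) a ->
  is_derive t 1 (fun s : R => f (x + s *: a)) ('D_a f (x + t *: a)).
Proof.
move=> fa.
have E : (fun h : R => h^-1 *: (f (h *: a + (x + t *: a)) - f (x + t *: a)))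
  = (fun h : R => h^-1 *:
      (((fun s : R => f (x + s *: a)) \o shift t) (h *: 1) - f (x + t *: a))).
  apply: funext => h /=; congr (_ *: (f _ - _)).
  by rewrite [h *: 1]mulr1 scalerDl addrCA addrC.
split; first by move: fa; rewrite /derivable /= E.
by rewrite /derive /= E.
Qed.

Lemma mean_value_line f a x (e : R) : 0 < e ->
  (forall t, 0 <= t <= e -> derivable f (x + t *: a) a) ->
  exists2 t, 0 <= t <= e & f (x + e *: a) - f x = e * 'D_a f (x + t *: a).
Proof.
move=> e0 fa.
have [||t te E] := @MVT R (fun s => f (x + s *: a))
  (fun s => 'D_a f (x + s *: a)) 0 e e0.
- move=> t; rewrite in_itv /= => /andP[t0 te].
  by apply: is_derive_line; apply: fa; rewrite !ltW.
- apply: derivable_within_continuous => t; rewrite in_itv /= => te.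
  by have [] := is_derive_line (fa _ te).
exists t; first by move: te; rewrite in_itv /= => /andP[t0 te]; rewrite !ltW.
by move: E; rewrite scale0r addr0 subr0 mulrC.
Qed.

(** The second difference on the left is symmetric in [a] and [b], the derivative
on the right is not: arbitrarily close to [x], the two mixed derivatives thus
take a common value, which is how [clairaut] compares them. *)
Lemma mean_value_mixed f a b x (e : R) : 0 < e ->
  (forall s t, 0 <= s <= e -> 0 <= t <= e ->
     derivable f (x + s *: a + t *: b) a /\
     derivable ('D_a f) (x + s *: a + t *: b) b) ->
  exists s t, [/\ 0 <= s <= e, 0 <= t <= e &
    f (x + e *: a + e *: b) - f (x + e *: a) - f (x + e *: b) + f x
    = e ^+ 2 * 'D_b ('D_a f) (x + s *: a + t *: b)].
Proof.
move=> e0 fab.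
have e_in : 0 <= e <= e by rewrite ltW /=.
have z_in : 0 <= (0 : R) <= e by rewrite lexx ltW.
(* The difference in direction b, to which the mean value theorem in direction a
   applies. *)
pose g y := f (y + e *: b) - f y.
have Dg s : 0 <= s <= e -> is_derive (x + s *: a) a g
    ('D_a f (x + s *: a + e *: b) - 'D_a f (x + s *: a)).
  move=> se; apply: is_deriveB; last first.
    by have [/derivableP + _] := fab s 0 se z_in; rewrite scale0r addr0.
  have [/derivableP [d1 d2] _] := fab s e se e_in.
  split.
    move: d1; rewrite /derivable /= => d1.
    by under eq_fun do rewrite -addrA.
  rewrite -d2 /derive /=.
  by under [in LHS]eq_fun do rewrite -addrA.
have [s se Es] : exists2 s, 0 <= s <= e &
    g (x + e *: a) - g x = e * 'D_a g (x + s *: a).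
  apply: (@mean_value_line g a x e e0) => s' s'e.
  have [dg _] := Dg s' s'e; exact: dg.
have [t te Et] : exists2 t, 0 <= t <= e &
    'D_a f (x + s *: a + e *: b) - 'D_a f (x + s *: a)
    = e * 'D_b ('D_a f) (x + s *: a + t *: b).
  apply: (@mean_value_line ('D_a f) b (x + s *: a) e e0) => t te.
  have [_ dab] := fab s t se te; exact: dab.
exists s, t; split=> //.
have [_ Dgs] := Dg s se.
by rewrite expr2 -mulrA -Et -Dgs -Es /g; ring.
Qed.

Lemma eq_of_nearby_values (P Q : V -> R) x :
  {for x, continuous P} -> {for x, continuous Q} ->
  (forall A : set V, nbhs x A -> exists y z, [/\ A y, A z & P y = Q z]) ->
  P x = Q x.
Proof.
move=> cP cQ PQ.
apply/eqP; rewrite -subr_eq0 -normr_le0; apply/ler_addgt0Pl => h h0.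
rewrite addr0.
have h2 : 0 < h / 2 by rewrite divr_gt0.
have close (g : V -> R) : {for x, continuous g} ->
    nbhs x [set y | `|g x - g y| < h / 2].
  by move=> cg; move/cvgrPdist_lt: (cg : g @ x --> g x); apply.
have [y [z [[Py _] [_ Qz] yz]]] := PQ _ (filterI (close P cP) (close Q cQ)).
rewrite (splitr h); apply: le_trans (ltW (ltrD Py Qz)).
rewrite yz (distrC (Q x)); apply: le_trans (ler_normD _ _).
by rewrite addrA subrK.
Qed.

Lemma clairaut f a b x Omega : open Omega -> Omega x ->
  (forall y, Omega y -> derivable f y a /\ derivable f y b) ->
  (forall y, Omega y -> derivable ('D_a f) y b /\ derivable ('D_b f) y a) ->
  {for x, continuous ('D_b ('D_a f))} -> {for x, continuous ('D_a ('D_b f))} ->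
  'D_b ('D_a f) x = 'D_a ('D_b f) x.
Proof.
move=> oO Ox d1 d2 cab cba; apply: eq_of_nearby_values cab cba _ => A xA.
have xO : nbhs x Omega by apply: open_nbhs_nbhs; split.
have /nbhs_ballP[r /= r0 rA] : nbhs x (Omega `&` A) by exact: filterI.
(* The size of the square keeps x + s a + t b within r / 2 of x. *)
pose e := r / (2 * (`|a| + `|b| + 1)).
have ab0 : 0 < `|a| + `|b| + 1 by rewrite ltr_wpDl ?addr_ge0.
have e0 : 0 < e by rewrite divr_gt0 ?mulr_gt0.
have box s t : 0 <= s <= e -> 0 <= t <= e -> ball x r (x + s *: a + t *: b).
  move=> /andP[s0 se] /andP[t0 te]; rewrite -ball_normE /ball_ /=.
  rewrite -addrA opprD addNKr normrN (le_lt_trans (ler_normD _ _)) //.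
  rewrite !normrZ (ger0_norm s0) (ger0_norm t0).
  have -> : r = e * (`|a| + `|b| + 1) + e * (`|a| + `|b| + 1).
    by rewrite /e; field; rewrite gt_eqF.
  have : s * `|a| <= e * `|a| by rewrite ler_wpM2r.
  have : t * `|b| <= e * `|b| by rewrite ler_wpM2r.
  have := mulr_ge0 (ltW e0) (normr_ge0 a).
  have := mulr_ge0 (ltW e0) (normr_ge0 b).
  by rewrite !mulrDr; lra.
have [|s [t [se te E1]]] := @mean_value_mixed f a b x e e0.
  move=> s t se te; have [yO _] := rA _ (box _ _ se te).
  split; first by have [d _] := d1 _ yO; exact: d.
  by have [d _] := d2 _ yO; exact: d.
have [|t' [s' [te' se' E2]]] := @mean_value_mixed f b a x e e0.
  move=> t' s' te' se'; have := box _ _ se' te'; rewrite addrAC => /rA[yO _].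
  split; first by have [_ d] := d1 _ yO; exact: d.
  by have [_ d] := d2 _ yO; exact: d.
exists (x + s *: a + t *: b), (x + s' *: a + t' *: b); split.
- by have [_ yA] := rA _ (box _ _ se te).
- by have [_ yA] := rA _ (box _ _ se' te').
apply: (mulfI (lt0r_neq0 (exprn_gt0 2 e0))).
rewrite (addrAC x (e *: b)) (addrAC x (t' *: b)) in E2.
have swap (p q z u : R) : p - q - z + u = p - z - q + u by rewrite (addrAC p).
exact: etrans (esym E1) (etrans (swap _ _ _ _) E2).
Qed.

End Clairaut.

(** * Fields of class C^k on an open set *)

Section Smoothness.
Context {R : realType} {Omega : set 'cV[R]_3}.
Hypothesis oO : open Omega.
Implicit Types (f g : 'cV[R]_3 -> R) (x : 'cV[R]_3) (k : nat) (q : 'I_3).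

Lemma near_open x (P : 'cV[R]_3 -> Prop) : Omega x ->
  (forall y, Omega y -> P y) -> \forall y \near x, P y.
Proof.
by move=> Ox PO; apply: filterS PO _; apply: open_nbhs_nbhs; split.
Qed.

Lemma eq_pd q f g x : Omega x -> (forall y, Omega y -> f y = g y) ->
  pd q f x = pd q g x.
Proof.
by move=> Ox fg; apply: (@near_eq_derive R _ R^o); apply: near_open.
Qed.

Lemma Ck_continuous k f x : Ck k Omega f -> Omega x -> {for x, continuous f}.
Proof. by case: k => [|k] [cf _]; apply: cf. Qed.

Lemma eq_continuous_at f g x : Omega x -> (forall y, Omega y -> f y = g y) ->
  {for x, continuous f} -> {for x, continuous g}.
Proof.
move=> Ox fg cf.
have gf : g @ x --> f x.
  apply: cvg_trans cf; have nfg : {near x, f =1 g} := near_open Ox fg.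
  exact: near_eq_cvg nfg.
by rewrite (fg x Ox) in gf.
Qed.

Lemma add_continuous_at f g x : {for x, continuous f} ->
  {for x, continuous g} -> {for x, continuous (fun y => f y + g y)}.
Proof. by move=> cf cg; exact: (@cvgD R R^o _ _ _ f g _ _ cf cg). Qed.

(** [Omega] is open, so that derivatives on [Omega] only see values on [Omega]. *)
Lemma eq_Ck k f g : (forall y, Omega y -> f y = g y) ->
  Ck k Omega f -> Ck k Omega g.
Proof.
elim: k f g => [|k IH] f g fg Cf.
  split=> // x Ox.
  by apply: (eq_continuous_at Ox fg); exact: (Ck_continuous Cf Ox).
split=> [x Ox|q].
  by apply: (eq_continuous_at Ox fg); exact: (Ck_continuous Cf Ox).
have [_ /(_ q) [dfq Cfq]] := Cf.
split=> [x Ox|].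
  by apply: (@near_eq_derivable R _ R^o) (dfq x Ox); apply: near_open Ox _.
by apply: IH Cfq => y Oy; exact: eq_pd.
Qed.

Lemma Ck_derivable k f q x : Ck k.+1 Omega f -> Omega x ->
  derivable f x (delta_mx q 0 : 'cV[R]_3).
Proof. by move=> [_ /(_ q) [df _]]; apply: df. Qed.

Lemma Ck_pd k f q : Ck k.+1 Omega f -> Ck k Omega (pd q f).
Proof. by move=> [_ /(_ q) []]. Qed.

Lemma Ck_leq k l f : (l <= k)%N -> Ck k Omega f -> Ck l Omega f.
Proof.
elim: l k f => [|l IH] k f.
  by move=> _ Cf; split=> // x; apply: (Ck_continuous Cf).
case: k => // k lk Cf.
split=> [x|i]; first exact: Ck_continuous Cf.
by split=> [x|]; [exact: Ck_derivable Cf | exact: IH lk (Ck_pd i Cf)].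
Qed.

Lemma pdD q f g x : Omega x -> Ck 1 Omega f -> Ck 1 Omega g ->
  pd q (fun y => f y + g y) x = pd q f x + pd q g x.
Proof.
move=> Ox Cf Cg.
by apply: (@deriveD R _ R^o); [exact: Ck_derivable Cf _ | exact: Ck_derivable Cg _].
Qed.

Lemma pdZ q c f x : Omega x -> Ck 1 Omega f ->
  pd q (fun y => c * f y) x = c * pd q f x.
Proof.
by move=> Ox Cf; apply: (@deriveZ R _ R^o f c); exact: Ck_derivable Cf _.
Qed.

Lemma pd_cst q (c : R) x : pd q (fun=> c) x = 0.
Proof. exact: (@derive_cst R _ R^o). Qed.

Lemma Ck_cst k (c : R) : Ck k Omega (fun=> c).
Proof.
elim: k c => [|k IH] c; first by split=> // x _; exact: cst_continuous.
split=> [x _|i]; first exact: cst_continuous.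
split=> [x _|]; first exact: (@derivable_cst R _ R^o).
by apply: eq_Ck (IH 0) => y _; rewrite pd_cst.
Qed.

Lemma CkD k f g : Ck k Omega f -> Ck k Omega g ->
  Ck k Omega (fun y => f y + g y).
Proof.
elim: k f g => [|k IH] f g Cf Cg.
  split=> // x Ox.
  exact: add_continuous_at (Ck_continuous Cf Ox) (Ck_continuous Cg Ox).
split=> [x Ox|i].
  by exact: add_continuous_at (Ck_continuous Cf Ox) (Ck_continuous Cg Ox).
split=> [x Ox|].
  by apply: (@derivableD R _ R^o); [exact: Ck_derivable Cf _|exact: Ck_derivable Cg _].
apply: eq_Ck (IH _ _ (Ck_pd i Cf) (Ck_pd i Cg)) => y Oy.
by rewrite pdD //; [apply: Ck_leq Cf | apply: Ck_leq Cg].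
Qed.

Lemma CkZ k c f : Ck k Omega f -> Ck k Omega (fun y => c * f y).
Proof.
elim: k f => [|k IH] f Cf.
  by split=> // x Ox; exact: cvgMr (Ck_continuous Cf Ox).
split=> [x Ox|i]; first by exact: cvgMr (Ck_continuous Cf Ox).
split=> [x Ox|].
  by apply: (@derivableZ R _ R^o f c); exact: Ck_derivable Cf _.
apply: eq_Ck (IH _ (Ck_pd i Cf)) => y Oy.
by rewrite pdZ //; apply: Ck_leq Cf.
Qed.

Lemma Ck_sum k (I : Type) (r : seq I) (F : I -> 'cV[R]_3 -> R) :
  (forall i, Ck k Omega (F i)) -> Ck k Omega (fun y => \sum_(i <- r) F i y).
Proof.
move=> CF; elim: r => [|i r IH].
  by apply: eq_Ck (Ck_cst k 0) => y _; rewrite big_nil.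
by apply: eq_Ck (CkD (CF i) IH) => y _; rewrite big_cons.
Qed.

Lemma pd_sum q (I : Type) (r : seq I) (F : I -> 'cV[R]_3 -> R) x : Omega x ->
  (forall i, Ck 1 Omega (F i)) ->
  pd q (fun y => \sum_(i <- r) F i y) x = \sum_(i <- r) pd q (F i) x.
Proof.
move=> Ox CF; elim: r => [|i r IH].
  by rewrite big_nil -[RHS](pd_cst q 0 x); apply: eq_pd => // y _; rewrite big_nil.
rewrite big_cons -IH -pdD //; last exact: Ck_sum.
by apply: eq_pd => // y _; rewrite big_cons.
Qed.

Lemma pdC p q f x : Omega x -> Ck 2 Omega f -> pd p (pd q f) x = pd q (pd p f) x.
Proof.
move=> Ox Cf; apply: (clairaut oO Ox).
- by move=> y Oy; split; apply: Ck_derivable Cf Oy.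
- by move=> y Oy; split; [have := Ck_pd q Cf|have := Ck_pd p Cf];
    move=> /Ck_derivable; apply.
- by apply: Ck_continuous (Ck_pd p (Ck_pd q Cf)) Ox.
- by apply: Ck_continuous (Ck_pd q (Ck_pd p Cf)) Ox.
Qed.

End Smoothness.

(** * Vector algebra in R^3 *)

Lemma I3_cases (P : 'I_3 -> Prop) : P 0 -> P 1 -> P 2%:R -> forall i, P i.
Proof.
move=> P0 P1 P2 [[|[|[|//]]] lti]; [move: P0|move: P1|move: P2]; congr (P _);
  exact: val_inj.
Qed.

Lemma sum_I3 (V : nmodType) (F : 'I_3 -> V) : \sum_i F i = F 0 + F 1 + F 2%:R.
Proof.
rewrite !big_ord_recl big_ord0 addr0 addrA.
by congr (F _ + F _ + F _); exact: val_inj.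
Qed.

Lemma sum_I1 (V : nmodType) (F : 'I_1 -> V) : \sum_i F i = F 0.
Proof. by rewrite big_ord1. Qed.

(** [cross] and [curl] compute their indices in Z/3; the next facts normalise
these indices once they are concrete. *)
Lemma I3_11 : (1 + 1 : 'I_3) = 2%:R. Proof. exact: val_inj. Qed.
Lemma I3_12 : (1 + 2%:R : 'I_3) = 0. Proof. exact: val_inj. Qed.
Lemma I3_21 : (2%:R + 1 : 'I_3) = 0. Proof. exact: val_inj. Qed.
Lemma I3_22 : (2%:R + 2%:R : 'I_3) = 1. Proof. exact: val_inj. Qed.
Lemma I3_eq01 : (0 == 1 :> 'I_3) = false. Proof. by []. Qed.
Lemma I3_eq02 : (0 == 2%:R :> 'I_3) = false. Proof. by []. Qed.
Lemma I3_eq10 : (1 == 0 :> 'I_3) = false. Proof. by []. Qed.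
Lemma I3_eq12 : (1 == 2%:R :> 'I_3) = false. Proof. by []. Qed.
Lemma I3_eq20 : (2%:R == 0 :> 'I_3) = false. Proof. by []. Qed.
Lemma I3_eq21 : (2%:R == 1 :> 'I_3) = false. Proof. by []. Qed.

Definition I3E := (I3_11, I3_12, I3_21, I3_22, I3_eq01, I3_eq02,
  I3_eq10, I3_eq12, I3_eq20, I3_eq21, eqxx).

Ltac expand_coords :=
  rewrite /dot /mxtrace;
  rewrite ?(mxE, sum_I3, sum_I1, I3E, andbT, andbF, mulr1n, mulr0n,
            add0r, mulr1, mul1r, mulr0, mul0r).

Section VectorAlgebra.
Context {R : realType}.
Implicit Types (a b c n w xi eta : 'cV[R]_3) (A U M : 'M[R]_3).

Lemma dotC a b : dot a b = dot b a.
Proof. by apply: eq_bigr => i _; rewrite mulrC. Qed.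

Lemma dotE a b : a^T *m b = (dot a b)%:M.
Proof.
apply/matrixP => i j; rewrite !ord1 mxE [RHS]mxE eqxx mulr1n.
by apply: eq_bigr => k _; rewrite mxE.
Qed.

Lemma dot_entry a b : dot a b = (a^T *m b) 0 0.
Proof. by rewrite dotE mxE eqxx mulr1n. Qed.

Lemma outer_mul a b c : a *m b^T *m c = dot b c *: a.
Proof. by rewrite -mulmxA dotE mul_mx_scalar. Qed.

Lemma dot_mul a U b : dot a (U *m b) = dot (U^T *m a) b.
Proof. by rewrite !dot_entry trmx_mul trmxK mulmxA. Qed.

Lemma crossC a b : cross a b = - cross b a.
Proof. by apply/colP; elim/I3_cases; expand_coords; ring. Qed.

Lemma cross_cross a b c : cross a (cross b c) = dot a c *: b - dot a b *: c.
Proof. by apply/colP; elim/I3_cases; expand_coords; ring. Qed.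

Lemma dot_cross a b c : dot a (cross b c) = dot b (cross c a).
Proof. by expand_coords; ring. Qed.

Lemma tr_mskw a : (mskw a)^T = - mskw a.
Proof. by apply/matrixP; elim/I3_cases; elim/I3_cases; expand_coords; ring. Qed.

Lemma dotN a b : dot a (- b) = - dot a b.
Proof. by rewrite !dot_entry mulmxN mxE. Qed.

Lemma tr_mul_mskw a n : a^T *m mskw n = - (cross n a)^T.
Proof. by rewrite -mskwE trmx_mul tr_mskw mulmxN opprK. Qed.

Lemma tr_mul_tr_mskw a n : a^T *m (mskw n)^T = (cross n a)^T.
Proof. by rewrite tr_mskw mulmxN tr_mul_mskw opprK. Qed.

Lemma crossv a : cross a a = 0.
Proof. by apply/colP; elim/I3_cases; expand_coords; ring. Qed.

Lemma PiFE n a : PiF n *m a = a - dot n a *: n.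
Proof. by rewrite mulmxBl mul1mx outer_mul. Qed.

Lemma tr_PiF n : (PiF n)^T = PiF n.
Proof. by rewrite linearB /= trmx1 trmx_mul trmxK. Qed.

Lemma dot_crossv n a : dot n (cross n a) = 0.
Proof.
by rewrite dot_cross dot_cross crossv /dot big1 // => i _; rewrite mxE mulr0.
Qed.

Lemma PiF_cross n a : PiF n *m cross n a = cross n a.
Proof. by rewrite PiFE dot_crossv scale0r subr0. Qed.

Lemma mskw_PiF n : mskw n *m PiF n = mskw n.
Proof. by rewrite mulmxBr mulmx1 mulmxA mskwE crossv mul0mx subr0. Qed.

Lemma PiF_mskw n : PiF n *m mskw n = mskw n.
Proof.
by apply: trmx_inj; rewrite trmx_mul tr_PiF tr_mskw mulNmx mskw_PiF.
Qed.

Lemma cross_PiF n a : cross n (PiF n *m a) = cross n a.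
Proof. by rewrite -!mskwE mulmxA mskw_PiF. Qed.

Lemma dot_PiF n a b : dot (PiF n *m a) b = dot a (PiF n *m b).
Proof. by rewrite dot_mul tr_PiF. Qed.

Lemma tr_sym U : (sym U)^T = sym U.
Proof. by rewrite /sym linearZ linearD /= trmxK addrC. Qed.

Lemma outer_tr_mul w eta M :
  w *m eta^T *m M = w *m (M^T *m eta)^T.
Proof. by rewrite -mulmxA trmx_mul trmxK. Qed.

Lemma trace_outer a b : \tr (a *m b^T) = dot b a.
Proof. by rewrite mxtrace_mulC dotE /mxtrace big_ord1 mxE eqxx mulr1n. Qed.

Lemma sym_outer_mul w eta n :
  sym (w *m eta^T) *m n = 2^-1 *: (dot eta n *: w + dot w n *: eta).
Proof. by rewrite /sym trmx_mul trmxK -scalemxAl mulmxDl !outer_mul. Qed.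

Lemma sym_conj M U : M *m sym U *m M^T = sym (M *m U *m M^T).
Proof.
by rewrite /sym -scalemxAr -scalemxAl mulmxDr mulmxDl !trmx_mul trmxK mulmxA.
Qed.

Lemma outer_delta (F : 'I_3 -> 'cV[R]_3) :
  \sum_q F q *m (delta_mx q 0 : 'cV[R]_3)^T = \matrix_(i, j) F j i 0.
Proof.
apply/matrixP => i j; rewrite summxE mxE (bigD1 j) //= big1 ?addr0.
  by rewrite !mxE big_ord1 mxE mxE !eqxx mulr1.
by move=> q qj; rewrite !mxE big_ord1 mxE mxE [j == q]eq_sym (negPf qj) mulr0.
Qed.

Lemma dot_row a A i : dot a (row i A)^T = (A *m a) i 0.
Proof. by rewrite mxE; apply: eq_bigr => j _; rewrite !mxE mulrC. Qed.

Lemma dot_delta a q : dot a (delta_mx q 0) = a q 0.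
Proof.
rewrite /dot (bigD1 q) //= big1 ?addr0; first by rewrite mxE !eqxx mulr1.
by move=> k kq; rewrite mxE (negPf kq) mulr0.
Qed.

Lemma sym_sub_mskw n (k : R) A : sym (A - k *: mskw n) = sym A.
Proof.
rewrite /sym [(_ - _)^T]linearB /= [(_ *: _)^T]linearZ /= tr_mskw.
rewrite scalerN opprK addrACA.
by rewrite [- _ + _]addrC subrr addr0.
Qed.

Lemma mxtrace_sym_mskw xi A : A^T = A ->
  \tr (A *m (mskw xi)^T) = 0.
Proof.
move=> As; have E : \tr (A *m (mskw xi)^T) = - \tr (A *m (mskw xi)^T).
  rewrite -{1}mxtrace_tr trmx_mul trmxK As mxtrace_mulC tr_mskw mulmxN linearN.
  by rewrite opprK.
by apply/eqP; move/eqP: E; rewrite -addr_eq0 -mulr2n mulrn_eq0.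
Qed.

Lemma mul_tr_mskw_mul n xi A : A *m (mskw xi)^T *m n = A *m cross n xi.
Proof. by rewrite -mulmxA tr_mskw mulNmx mskwE -crossC. Qed.

Lemma cross_Sinv_tr n A :
  cross n ((Sinv A)^T *m n) = cross n (A *m n).
Proof.
rewrite /Sinv linearB /= trmxK tr_scalar_mx mulmxBl mul_scalar_mx.
by rewrite -!mskwE mulmxBr -scalemxAr !mskwE crossv scaler0 subr0.
Qed.

(** The vector whose cross product is the skew part of [A]. *)
Definition axial A : 'cV[R]_3 :=
  \col_i (2^-1 * (A (i + 2%:R) (i + 1) - A (i + 1) (i + 2%:R))).

Lemma mskw_axial A : A = sym A + mskw (axial A).
Proof.
by apply/matrixP; elim/I3_cases; elim/I3_cases; expand_coords; field.
Qed.

Lemma tr_mskw_mskw a b : \tr (mskw a *m mskw b) = - 2 * dot a b.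
Proof. by expand_coords; ring. Qed.

Lemma mskw_mul_mskw a b : mskw a *m mskw b = b *m a^T - (dot a b)%:M.
Proof.
apply/matrixP => i j; have := cross_cross a b (delta_mx j 0).
rewrite -!mskwE mulmxA -outer_mul -mul_scalar_mx -mulmxBl -!colE.
by move/colP/(_ i); rewrite [col _ _ _ _]mxE [col _ (_ - _) _ _]mxE.
Qed.

End VectorAlgebra.

(** * Linear maps of matrices *)

Section Linear.
Context {R : realType}.
Implicit Types (V W : lmodType R).

Lemma linear_at0 V W (L : V -> W) : linear L -> L 0 = 0.
Proof. by move=> /(_ (-1) 0 0); rewrite scaler0 addr0 scaleN1r addNr. Qed.

Lemma linear_sum_fun V W (L : V -> W) (I : Type) (r : seq I)
    (F : I -> V) : linear L -> L (\sum_(i <- r) F i) = \sum_(i <- r) L (F i).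
Proof.
move=> lL; have LD : {morph L : a b / a + b}.
  by move=> a b; rewrite -[a]scale1r lL !scale1r.
exact: (big_morph L LD (linear_at0 lL)).
Qed.

Lemma linearZ_fun V W (L : V -> W) c v :
  linear L -> L (c *: v) = c *: L v.
Proof. by move=> lL; rewrite -[c *: v]addr0 lL linear_at0 // addr0. Qed.

Lemma linear_entries m p (L : 'M[R]_(m, p) -> R^o) A : linear L ->
  L A = \sum_i \sum_j L (delta_mx i j) * A i j.
Proof.
move=> lL; rewrite {1}[A]matrix_sum_delta linear_sum_fun //.
apply: eq_bigr => i _; rewrite linear_sum_fun //; apply: eq_bigr => j _.
by rewrite -[in LHS](addr0 (_ *: _)) lL linear_at0 // addr0 mulrC.
Qed.

Lemma linear_entry m p m' p' (L : 'M[R]_(m, p) -> 'M[R]_(m', p')) i j :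
  linear L -> linear (fun A => L A i j : R^o).
Proof. by move=> lL a A B; rewrite lL !mxE. Qed.

(** One closure lemma per operation occurring in a symbol, for [solve_linear]. *)
Lemma linear_idfun V : linear (fun v : V => v). Proof. by []. Qed.

Lemma linear_mulmxl V m p r (M : 'M[R]_(m, p)) (f : V -> 'M_(p, r)) :
  linear f -> linear (fun v => M *m f v).
Proof. by move=> lf a u v; rewrite lf linearP. Qed.

Lemma linear_mulmxr V m p r (M : 'M[R]_(p, r)) (f : V -> 'M_(m, p)) :
  linear f -> linear (fun v => f v *m M).
Proof. by move=> lf a u v; rewrite lf mulmxDl scalemxAl. Qed.

Lemma linear_trmx V m p (f : V -> 'M[R]_(m, p)) :
  linear f -> linear (fun v => (f v)^T).
Proof. by move=> lf a u v; rewrite lf linearP. Qed.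

Lemma linear_mxtrace V m (f : V -> 'M[R]_m) :
  linear f -> linear (fun v => \tr (f v) : R^o).
Proof. by move=> lf a u v; rewrite lf linearP. Qed.

Lemma linear_add V V' (f g : V -> V') :
  linear f -> linear g -> linear (fun v => f v + g v).
Proof. by move=> lf lg a u v; rewrite lf lg scalerDr addrACA. Qed.

Lemma linear_opp V V' (f : V -> V') : linear f -> linear (fun v => - f v).
Proof. by move=> lf a u v; rewrite lf opprD scalerN. Qed.

Lemma linear_scale V V' c (f : V -> V') : linear f -> linear (fun v => c *: f v).
Proof. by move=> lf a u v; rewrite lf scalerDr !scalerA mulrC. Qed.

Lemma linear_scalel V V' (w : V') (f : V -> R^o) :
  linear f -> linear (fun v => f v *: w).
Proof. by move=> lf a u v; rewrite lf scalerDl scalerA. Qed.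

Lemma linear_scalar V m (f : V -> R^o) :
  linear f -> linear (fun v => (f v)%:M : 'M[R]_m).
Proof.
move=> lf a u v; rewrite lf; apply/matrixP => i j; rewrite !mxE.
by rewrite mulrnDl mulrnAr.
Qed.

Lemma linear_sym V (f : V -> 'M[R]_3) : linear f -> linear (fun v => sym (f v)).
Proof. by move=> lf; apply: linear_scale; apply: linear_add (linear_trmx _). Qed.

Lemma linear_dev V (f : V -> 'M[R]_3) : linear f -> linear (fun v => dev (f v)).
Proof.
move=> lf; apply: linear_add (linear_opp _) => //; apply: linear_scalar.
by apply: (@linear_scale _ R^o); apply: linear_mxtrace.
Qed.

Lemma linear_Sinv V (f : V -> 'M[R]_3) : linear f -> linear (fun v => Sinv (f v)).
Proof.
move=> lf; apply: linear_add (linear_opp _); first exact: linear_trmx.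
by apply: linear_scalar; apply: (@linear_scale _ R^o); apply: linear_mxtrace.
Qed.

Lemma linear_crossr V a (f : V -> 'cV[R]_3) :
  linear f -> linear (fun v => cross a (f v)).
Proof. by move=> lf c u v; rewrite -!mskwE lf linearP. Qed.

Lemma linear_crossl V a (f : V -> 'cV[R]_3) :
  linear f -> linear (fun v => cross (f v) a).
Proof.
move=> lf c u v; rewrite !(crossC _ a) (linear_crossr a lf).
by rewrite opprD scalerN.
Qed.

Lemma linear_dotr V a (f : V -> 'cV[R]_3) :
  linear f -> linear (fun v => dot a (f v) : R^o).
Proof. by move=> lf c u v; rewrite !dot_entry lf linearP !mxE. Qed.

Lemma linear_dotl V a (f : V -> 'cV[R]_3) :
  linear f -> linear (fun v => dot (f v) a : R^o).
Proof. by move=> lf c u v; rewrite !(dotC _ a); apply: linear_dotr. Qed.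

End Linear.

Ltac solve_linear :=
  repeat first
  [ exact: linear_idfun | apply: linear_sym | apply: linear_dev
  | apply: linear_Sinv | apply: linear_crossr | apply: linear_crossl
  | apply: linear_dotr | apply: linear_dotl | apply: linear_scalar
  | apply: linear_mxtrace | apply: linear_trmx | apply: linear_mulmxl
  | apply: linear_mulmxr | apply: linear_opp | apply: linear_add
  | apply: linear_scalel | apply: linear_scale ].

(** * Constant-coefficient operators and their symbols *)

Section Symbols.
Context {R : realType}.
Implicit Types (m p : nat).

Definition pdmx m p (q : 'I_3) (G : 'cV[R]_3 -> 'M[R]_(m, p)) x : 'M[R]_(m, p) :=
  \matrix_(i, j) pd q (fun y => G y i j) x.

(** The first-order operator with symbol [B]: formally, replace [xi] by the
gradient in [B xi A]. *)
Definition symop m p (W : lmodType R) (B : 'cV[R]_3 -> 'M[R]_(m, p) -> W)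
    (G : 'cV[R]_3 -> 'M[R]_(m, p)) x : W :=
  \sum_q B (delta_mx q 0) (pdmx q G x).

Context {Omega : set 'cV[R]_3}.
Hypothesis oO : open Omega.

Lemma Ck_lin m p k (L : 'M[R]_(m, p) -> R^o) G : linear L ->
  Ckmx k Omega G -> Ck k Omega (fun y => L (G y)).
Proof.
move=> lL CG.
apply: (@eq_Ck _ _ oO k (fun y => \sum_i \sum_j L (delta_mx i j) * G y i j)).
  by move=> y _; rewrite (linear_entries (G y) lL).
by apply: Ck_sum => // i; apply: Ck_sum => // j; apply: CkZ => //; apply: CG.
Qed.

Lemma Ckmx_lin m p m' p' k (L : 'M[R]_(m, p) -> 'M[R]_(m', p')) G : linear L ->
  Ckmx k Omega G -> Ckmx k Omega (fun y => L (G y)).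
Proof. by move=> lL CG i j; exact: (Ck_lin (linear_entry i j lL)). Qed.

Lemma pd_lin m p q (L : 'M[R]_(m, p) -> R^o) G x : linear L ->
  Ckmx 1 Omega G -> Omega x -> pd q (fun y => L (G y)) x = L (pdmx q G x).
Proof.
move=> lL CG Ox.
rewrite (eq_pd oO q (g := fun y => \sum_i \sum_j L (delta_mx i j) * G y i j)) //;
  last by move=> y _; rewrite (linear_entries (G y) lL).
rewrite (linear_entries _ lL) (pd_sum oO) //; last first.
  by move=> i; apply: Ck_sum => // j; apply: CkZ => //; apply: CG.
apply: eq_bigr => i _; rewrite (pd_sum oO) //; last first.
  by move=> j; apply: CkZ => //; apply: CG.
by apply: eq_bigr => j _; rewrite (pdZ q _ Ox (CG i j)) mxE.
Qed.

(** Entrywise differentiation commutes with every constant linear map; this is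
what lets an operator be pushed through the algebra of a field. *)
Lemma pdmx_lin m p m' p' q (L : 'M[R]_(m, p) -> 'M[R]_(m', p')) G x : linear L ->
  Ckmx 1 Omega G -> Omega x -> pdmx q (fun y => L (G y)) x = L (pdmx q G x).
Proof.
move=> lL CG Ox; apply/matrixP => i j; rewrite mxE.
exact: (pd_lin q (linear_entry i j lL)).
Qed.

Lemma eq_pdmx m p q (G H : 'cV[R]_3 -> 'M[R]_(m, p)) x : Omega x ->
  (forall y, Omega y -> G y = H y) -> pdmx q G x = pdmx q H x.
Proof.
move=> Ox GH; apply/matrixP => i j; rewrite [LHS]mxE [RHS]mxE.
by apply: (eq_pd oO) => // y Oy; rewrite GH.
Qed.

Lemma eq_symop m p (W : lmodType R) (B : 'cV[R]_3 -> 'M[R]_(m, p) -> W) G H x :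
  Omega x ->
  (forall y, Omega y -> G y = H y) -> symop B G x = symop B H x.
Proof. by move=> Ox GH; apply: eq_bigr => q _; rewrite (eq_pdmx q Ox GH). Qed.

Lemma eq_Ckmx m p k (G H : 'cV[R]_3 -> 'M[R]_(m, p)) :
  (forall y, Omega y -> G y = H y) -> Ckmx k Omega G -> Ckmx k Omega H.
Proof.
by move=> GH CG i j; apply: eq_Ck (CG i j) => // y Oy; rewrite GH.
Qed.

Lemma Ckmx_leq m p k l (G : 'cV[R]_3 -> 'M[R]_(m, p)) : (l <= k)%N ->
  Ckmx k Omega G -> Ckmx l Omega G.
Proof. by move=> lk CG i j; apply: Ck_leq (CG i j). Qed.

Lemma Ckmx_pdmx m p k q (G : 'cV[R]_3 -> 'M[R]_(m, p)) :
  Ckmx k.+1 Omega G -> Ckmx k Omega (pdmx q G).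
Proof.
move=> CG i j; apply: eq_Ck (Ck_pd q (CG i j)) => // y _; by rewrite mxE.
Qed.

Lemma pdmxC m p q r (G : 'cV[R]_3 -> 'M[R]_(m, p)) x : Omega x ->
  Ckmx 2 Omega G -> pdmx q (pdmx r G) x = pdmx r (pdmx q G) x.
Proof.
move=> Ox CG; apply/matrixP => i j.
have E s : (fun y => pdmx s G y i j) = pd s (fun y => G y i j).
  by apply: funext => y; rewrite mxE.
rewrite [LHS]mxE [RHS]mxE !E.
exact: (pdC oO).
Qed.

Section Composition.
Variables (m p m' p' : nat) (B : 'cV[R]_3 -> 'M[R]_(m, p) -> 'M[R]_(m', p')).
Hypothesis lB : forall xi, linear (B xi).

Lemma Ckmx_symop k G : Ckmx k.+1 Omega G -> Ckmx k Omega (symop B G).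
Proof.
move=> CG i j.
apply: (@eq_Ck _ _ oO k (fun y => \sum_q B (delta_mx q 0) (pdmx q G y) i j)).
  by move=> y _; rewrite summxE.
apply: Ck_sum => // q; apply: (Ck_lin (linear_entry i j (lB _))).
exact: Ckmx_pdmx.
Qed.

Lemma pdmx_symop q G x : Ckmx 2 Omega G -> Omega x ->
  pdmx q (symop B G) x = \sum_r B (delta_mx r 0) (pdmx q (pdmx r G) x).
Proof.
move=> CG Ox; apply/matrixP => i j; rewrite mxE summxE.
rewrite (eq_pd oO q (g := fun y => \sum_r B (delta_mx r 0) (pdmx r G y) i j)) //;
  last by move=> y _; rewrite summxE.
have lij r := linear_entry i j (lB (delta_mx r 0)).
have CrG r := Ckmx_pdmx r CG.
rewrite (pd_sum oO) //; last by move=> r; exact: (Ck_lin (lij r) (CrG r)).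
by apply: eq_bigr => r _; rewrite (pd_lin q (lij r) (CrG r) Ox).
Qed.

Lemma symop_comp (W : lmodType R) (C : 'cV[R]_3 -> 'M[R]_(m', p') -> W) G x :
  (forall xi, linear (C xi)) -> Ckmx 2 Omega G -> Omega x ->
  symop C (symop B G) x
  = \sum_q \sum_r C (delta_mx q 0) (B (delta_mx r 0) (pdmx q (pdmx r G) x)).
Proof.
move=> lC CG Ox; apply: eq_bigr => q _.
by rewrite pdmx_symop // linear_sum_fun.
Qed.

End Composition.

Lemma symop_lin m p m' p' (W : lmodType R) (L : 'M[R]_(m, p) -> 'M[R]_(m', p'))
    (C : 'cV[R]_3 -> 'M[R]_(m', p') -> W) G x : linear L ->
  Ckmx 1 Omega G -> Omega x ->
  symop C (fun y => L (G y)) x = symop (fun xi A => C xi (L A)) G x.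
Proof.
by move=> lL CG Ox; apply: eq_bigr => q _; rewrite (pdmx_lin q lL CG Ox).
Qed.

Lemma lin_symop m p (W W' : lmodType R) (L : W -> W')
    (B : 'cV[R]_3 -> 'M[R]_(m, p) -> W) G x : linear L ->
  L (symop B G x) = symop (fun xi A => L (B xi A)) G x.
Proof. by move=> lL; rewrite /symop linear_sum_fun. Qed.

(** Since [d_q d_r G] is symmetric in [q] and [r], a sum over [q] and [r] of
terms linear in it only depends on the symmetrisation of these terms.  The
predicate [P] records a linear constraint on the values of the field, such as
symmetry, that its derivatives inherit. *)
Lemma second_order_symbol m p m1 p1 m2 p2 (W : lmodType R)
    (P : 'M[R]_(m, p) -> Prop)
    (B : 'cV[R]_3 -> 'M[R]_(m1, p1) -> W)
    (B' : 'cV[R]_3 -> 'M[R]_(m, p) -> 'M[R]_(m1, p1))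
    (C : 'cV[R]_3 -> 'M[R]_(m2, p2) -> W)
    (C' : 'cV[R]_3 -> 'M[R]_(m, p) -> 'M[R]_(m2, p2)) G x :
  (forall xi, linear (B xi)) -> (forall xi, linear (B' xi)) ->
  (forall xi, linear (C xi)) -> (forall xi, linear (C' xi)) ->
  Ckmx 2 Omega G -> Omega x ->
  (forall q r, P (pdmx q (pdmx r G) x)) ->
  (forall xi eta A, P A ->
     B xi (B' eta A) + B eta (B' xi A) = C xi (C' eta A) + C eta (C' xi A)) ->
  symop B (symop B' G) x = symop C (symop C' G) x.
Proof.
move=> lB lB' lC lC' CG Ox PG BC; rewrite !symop_comp //.
have dbl (w w' : W) : w *+ 2 = w' *+ 2 -> w = w'.
  have half (z : W) : (2^-1 : R) *: (z *+ 2) = z.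
    by rewrite -[z *+ 2](@scaler_nat R) scalerA mulVf ?pnatr_eq0 // scale1r.
  by move=> E; rewrite -(half w) E half.
have sym2 (F : 'I_3 -> 'I_3 -> W) :
    (\sum_q \sum_r F q r) *+ 2 = \sum_q \sum_r (F q r + F r q).
  rewrite mulr2n {2}exchange_big -big_split; apply: eq_bigr => q _ /=.
  by rewrite -big_split.
apply: dbl; rewrite !sym2; apply: eq_bigr => q _; apply: eq_bigr => r _.
by rewrite (pdmxC r q) // BC.
Qed.

End Symbols.

(** * Symbols of the differential operators *)

Section Operators.
Context {R : realType}.
Implicit Types (n x xi eta w : 'cV[R]_3) (u : 'cV[R]_3 -> 'cV[R]_3).
Implicit Types (U : 'cV[R]_3 -> 'M[R]_3).

Lemma eq_symbol m p (W : lmodType R) (B C : 'cV[R]_3 -> 'M[R]_(m, p) -> W) G x :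
  (forall xi A, B xi A = C xi A) -> symop B G x = symop C G x.
Proof. by move=> BC; apply: eq_bigr => q _; rewrite BC. Qed.

Lemma pdmxE m p q (G : 'cV[R]_3 -> 'M[R]_(m, p)) x i j :
  pdmx q G x i j = pd q (fun y => G y i j) x.
Proof. by rewrite mxE. Qed.

Lemma row_entry U i k :
  (fun y => (row i (U y))^T k 0) = (fun y => U y i k).
Proof. by apply: funext => y; rewrite !mxE. Qed.

Lemma vgrad_op u x : vgrad u x = symop (fun xi w => w *m xi^T) u x.
Proof.
by rewrite /symop outer_delta; apply/matrixP => i j; rewrite !mxE.
Qed.

Lemma def_op u x : def u x = symop (fun xi w => sym (w *m xi^T)) u x.
Proof.
by rewrite /def vgrad_op lin_symop //; apply: linear_sym; solve_linear.
Qed.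

Lemma vcurl_op u x : vcurl u x = symop (fun xi w => cross xi w) u x.
Proof.
apply/colP => i; rewrite mxE /symop summxE -!pdmxE.
pose D q := pdmx q u x; rewrite -/(D _) -/(D _).
rewrite [RHS](eq_bigr (fun q => cross (delta_mx q 0) (D q) i 0)) //.
by move: D => D; elim/I3_cases: i; expand_coords; ring.
Qed.

Lemma curl_op U x : curl U x = symop (fun xi A => A *m (mskw xi)^T) U x.
Proof.
apply/matrixP => i j; rewrite mxE [LHS]mxE /symop summxE !row_entry -!pdmxE.
pose D q := pdmx q U x; rewrite -/(D _) -/(D _).
rewrite [RHS](eq_bigr (fun q => (D q *m (mskw (delta_mx q 0))^T) i j)) //.
by move: D => D; elim/I3_cases: j; expand_coords; ring.
Qed.

Lemma vgradF_op n u x :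
  vgradF n u x = symop (fun xi w => w *m (PiF n *m xi)^T) u x.
Proof.
have -> : vgradF n u x = vgrad u x *m PiF n.
  apply/matrixP => i j; rewrite mxE [LHS]mxE [RHS]mxE.
  by apply: eq_bigr => k _; rewrite mulrC -{1}(tr_PiF n) !mxE.
rewrite vgrad_op (lin_symop (L := fun A => A *m PiF n)); last by solve_linear.
by apply: eq_symbol => xi w; rewrite trmx_mul tr_PiF mulmxA.
Qed.

Lemma defF_op n u x :
  defF n u x = symop (fun xi w => sym (w *m (PiF n *m xi)^T)) u x.
Proof.
by rewrite /defF -/(sym _) vgradF_op lin_symop //; apply: linear_sym; solve_linear.
Qed.

Lemma vcurlF_op n u x :
  vcurlF n u x = symop (fun xi w => w *m (cross n xi)^T) u x.
Proof.
have -> : vcurlF n u x = vgrad u x *m (mskw n)^T.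
  apply/matrixP => i j; rewrite mxE /gradFperp -mskwE [LHS]mxE [RHS]mxE.
  by apply: eq_bigr => k _; rewrite mulrC !mxE.
rewrite vgrad_op (lin_symop (L := fun A => A *m (mskw n)^T)); last by solve_linear.
by apply: eq_symbol => xi w; rewrite -mulmxA tr_mul_tr_mskw.
Qed.

Lemma divF_op n u x :
  divF n u x = symop (W := R^o) (fun xi w => dot (PiF n *m xi) w) u x.
Proof.
have -> : divF n u x = \tr (vgradF n u x).
  by apply: eq_bigr => i _; rewrite [RHS]mxE.
rewrite vgradF_op (lin_symop (W' := R^o) (L := @mxtrace R 3)); last first.
  by apply: linear_mxtrace; solve_linear.
by apply: eq_symbol => xi w; rewrite trace_outer.
Qed.

Lemma rotF_op n u x :
  rotF n u x = symop (W := R^o) (fun xi w => dot (cross n xi) w) u x.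
Proof.
have -> : rotF n u x = \tr (vcurlF n u x).
  by apply: eq_bigr => i _; rewrite [RHS]mxE.
rewrite vcurlF_op (lin_symop (W' := R^o) (L := @mxtrace R 3)); last first.
  by apply: linear_mxtrace; solve_linear.
by apply: eq_symbol => xi w; rewrite trace_outer.
Qed.

Lemma pdmx_row q i U x :
  pdmx q (fun y => (row i (U y))^T) x = (row i (pdmx q U x))^T.
Proof.
by apply/colP => j; rewrite [LHS]mxE row_entry !mxE.
Qed.

Lemma mdivF_op n U x : mdivF n U x = symop (fun xi A => A *m (PiF n *m xi)) U x.
Proof.
apply/colP => i; rewrite mxE divF_op /symop summxE.
by apply: eq_bigr => q _; rewrite pdmx_row dot_row.
Qed.

Lemma mrotF_op n U x : mrotF n U x = symop (fun xi A => A *m cross n xi) U x.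
Proof.
apply/colP => i; rewrite mxE rotF_op /symop summxE.
by apply: eq_bigr => q _; rewrite pdmx_row dot_row.
Qed.

Lemma dnmx_op n U x : dnmx n U x = symop (fun xi A => dot n xi *: A) U x.
Proof.
apply/matrixP => i j; rewrite mxE /symop summxE; apply: eq_bigr => q _.
by rewrite dot_delta !mxE.
Qed.

Lemma hessF_op n f x :
  hessF n f x = symop (fun xi w => PiF n *m xi *m w^T) (gradF n f) x.
Proof.
have -> : hessF n f x = (vgradF n (gradF n f) x)^T.
  by apply/matrixP => i j; rewrite [LHS]mxE [RHS]mxE [RHS]mxE.
rewrite vgradF_op (lin_symop (L := @trmx R 3 3)); last first.
  by apply: linear_trmx; solve_linear.
by apply: eq_symbol => xi w; rewrite trmx_mul trmxK.
Qed.

Lemma symcurl_op U x :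
  symcurl U x = symop (fun xi A => sym (A *m (mskw xi)^T)) U x.
Proof.
by rewrite /symcurl curl_op lin_symop //; apply: linear_sym; solve_linear.
Qed.

Lemma devdef_op u x :
  devdef u x = symop (fun xi w => dev (sym (w *m xi^T))) u x.
Proof.
rewrite /devdef def_op lin_symop //.
by apply: linear_dev; solve_linear.
Qed.

End Operators.

Section Regularity.
Context {R : realType} {Omega : set 'cV[R]_3}.
Hypothesis oO : open Omega.
Implicit Types (x : 'cV[R]_3) (u : 'cV[R]_3 -> 'cV[R]_3).
Implicit Types (U V : 'cV[R]_3 -> 'M[R]_3).

Lemma pdmx_tr q U x : pdmx q (fun y => (U y)^T) x = (pdmx q U x)^T.
Proof.
apply/matrixP => i j; rewrite [LHS]mxE [RHS]mxE [RHS]mxE.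
by congr (pd q _ x); apply: funext => y; rewrite mxE.
Qed.

Lemma pdmx_symmetric q U x : (forall y, Omega y -> (U y)^T = U y) -> Omega x ->
  (pdmx q U x)^T = pdmx q U x.
Proof. by move=> US Ox; rewrite -pdmx_tr; apply: (eq_pdmx oO). Qed.

Lemma Ckmx_vcurl k u : Ckmx k.+1 Omega u -> Ckmx k Omega (vcurl u).
Proof.
move=> Cu; rewrite (funext (vcurl_op u)).
by apply: Ckmx_symop => // xi; solve_linear.
Qed.

Lemma Ckmx_def k u : Ckmx k.+1 Omega u -> Ckmx k Omega (def u).
Proof.
move=> Cu; rewrite (funext (def_op u)).
by apply: Ckmx_symop => // xi; solve_linear.
Qed.

Lemma Ckmx_curl k U : Ckmx k.+1 Omega U -> Ckmx k Omega (curl U).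
Proof.
move=> CU; rewrite (funext (curl_op U)).
by apply: Ckmx_symop => // xi; solve_linear.
Qed.

Lemma eq_curl U V x : Omega x -> (forall y, Omega y -> U y = V y) ->
  curl U x = curl V x.
Proof. by move=> Ox UV; rewrite !curl_op; exact: (eq_symop oO). Qed.

Lemma eq_hessF n f g x : Omega x -> (forall y, Omega y -> f y = g y) ->
  hessF n f x = hessF n g x.
Proof.
move=> Ox fg; rewrite !hessF_op; apply: (eq_symop oO _ Ox) => y Oy.
rewrite /gradF; congr (_ *m _); apply/colP => i; rewrite [LHS]mxE [RHS]mxE.
exact: (eq_pd oO).
Qed.

Lemma grad_dot n u x : Ckmx 1 Omega u -> Omega x ->
  grad (fun y => dot (u y) n) x = symop (fun xi w => dot w n *: xi) u x.
Proof.
move=> Cu Ox; apply/colP => i; rewrite mxE.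
rewrite (pd_lin oO i (L := fun w => dot w n)) //; last by solve_linear.
rewrite /symop summxE (bigD1 i) //= big1 ?addr0 => [|q qi].
  by rewrite [RHS]mxE [X in _ = _ * X]mxE !eqxx mulr1.
by rewrite mxE [X in _ * X = _]mxE eq_sym (negPf qi) mulr0.
Qed.

Lemma gradF_dot n u x : Ckmx 1 Omega u -> Omega x ->
  gradF n (fun y => dot (u y) n) x
  = symop (fun xi w => dot w n *: (PiF n *m xi)) u x.
Proof.
move=> Cu Ox; rewrite /gradF grad_dot //.
rewrite (lin_symop (L := fun w => PiF n *m w)); last by solve_linear.
by apply: eq_symbol => xi w; rewrite -scalemxAr.
Qed.

Lemma curlF_dot n u x : Ckmx 1 Omega u -> Omega x ->
  curlF n (fun y => dot (u y) n) x
  = symop (fun xi w => dot w n *: cross n xi) u x.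
Proof.
move=> Cu Ox; rewrite /curlF /gradFperp grad_dot //.
rewrite (lin_symop (L := fun w => cross n w)); last by solve_linear.
by apply: eq_symbol => xi w; rewrite -!mskwE -scalemxAr.
Qed.

End Regularity.

(** * The linearised second fundamental form *)

Section SecondFundamentalForm.
Context {R : realType} {Omega : set 'cV[R]_3}.
Hypothesis oO : open Omega.
Implicit Types (n x xi eta w : 'cV[R]_3) (A : 'M[R]_3).
Implicit Types (u : 'cV[R]_3 -> 'cV[R]_3) (U S : 'cV[R]_3 -> 'M[R]_3).

(** Up to sign, twice the first variation of the second fundamental form of the
plane normal to [n] under the perturbation [U] of the Euclidean metric. *)
Definition sff n U x : 'M[R]_3 :=
  2 *: defF n (fun y => PiF n *m U y *m n) x - PiF n *m dnmx n U x *m PiF n.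

Definition sff_symbol n xi A : 'M[R]_3 :=
  2 *: sym (PiF n *m A *m n *m (PiF n *m xi)^T)
  - dot n xi *: (PiF n *m A *m PiF n).

Lemma linear_sff_symbol n xi : linear (sff_symbol n xi).
Proof. rewrite /sff_symbol; solve_linear. Qed.

Lemma sff_op n U x : Ckmx 1 Omega U -> Omega x ->
  sff n U x = symop (sff_symbol n) U x.
Proof.
move=> CU Ox; rewrite /sff defF_op dnmx_op.
rewrite (symop_lin oO (L := fun A => PiF n *m A *m n)) //; last by solve_linear.
rewrite (lin_symop (L := fun A => 2 *: A)); last by solve_linear.
rewrite (lin_symop (L := fun A => PiF n *m A *m PiF n)); last by solve_linear.
rewrite /symop -sumrB; apply: eq_bigr => q _.
by rewrite /sff_symbol -scalemxAr -scalemxAl.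
Qed.

Lemma Ckmx_sff k n U : Ckmx k.+1 Omega U -> Ckmx k Omega (sff n U).
Proof.
move=> CU; have CU1 : Ckmx 1 Omega U by apply: Ckmx_leq CU.
apply: (@eq_Ckmx _ _ oO _ _ _ (symop (sff_symbol n) U)) => [y Oy|].
  by rewrite (sff_op n CU1 Oy).
by apply: Ckmx_symop => // xi; exact: linear_sff_symbol.
Qed.

Lemma sff_symbol_sym_outer n xi eta w :
  sff_symbol n xi (sym (w *m eta^T)) =
  dot eta n *: sym (PiF n *m w *m (PiF n *m xi)^T)
  + dot w n *: sym (PiF n *m eta *m (PiF n *m xi)^T)
  - dot n xi *: sym (PiF n *m w *m (PiF n *m eta)^T).
Proof.
rewrite /sff_symbol.
have -> : PiF n *m sym (w *m eta^T) *m PiF n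
    = sym (PiF n *m w *m (PiF n *m eta)^T).
  by rewrite -{2}(tr_PiF n) sym_conj mulmxA outer_tr_mul trmxK.
rewrite -(mulmxA (PiF n)) sym_outer_mul.
rewrite -scalemxAr mulmxDr -!scalemxAr.
move: (PiF n *m w) (PiF n *m eta) (PiF n *m xi) => a b c.
by apply/matrixP => i j; rewrite /sym !(mxE, sum_I1); field.
Qed.

(** To first order, perturbing the Euclidean metric by [2 def u] amounts to pulling
it back along the flow of [u], which maps the plane to the graph of [u . n]; the
linearised second fundamental form of a graph is a Hessian. *)
Lemma sff_def n u x : Ckmx 2 Omega u -> Omega x ->
  sff n (def u) x = hessF n (fun y => dot (u y) n) x.
Proof.
move=> Cu Ox; have Cu1 : Ckmx 1 Omega u by apply: Ckmx_leq Cu.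
rewrite hessF_op (eq_symop oO _ Ox (fun y Oy => gradF_dot oO n Cu1 Oy)).
rewrite (sff_op n (Ckmx_def oO Cu) Ox) (funext (def_op u)).
apply: (second_order_symbol oO (P := fun=> True)) => //;
  try by move=> xi; solve_linear.
(* The terms with a factor n . xi or n . eta cancel under symmetrisation. *)
move=> xi eta w _; rewrite !sff_symbol_sym_outer (dotC n) (dotC n).
move: (PiF n *m w) (PiF n *m eta) (PiF n *m xi) => a b c.
by apply/matrixP => i j; rewrite /sym !(mxE, sum_I1); field.
Qed.

(** By [cross_cross] the left-hand side is
[(n . b) eta - (n . eta) b] with [b := A (n x xi)].  The correction term on the right
is antisymmetric in [xi] and [eta], hence invisible to second derivatives. *)
Lemma linearized_codazzi_symbol n xi eta A : A^T = A ->
  cross n ((A *m (mskw eta)^T)^T *m (mskw xi)^T *m n)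
  = sff_symbol n eta A *m cross n xi
    - dot eta (cross n xi) *: (PiF n *m A *m n).
Proof.
move=> As; rewrite mul_tr_mskw_mul trmx_mul trmxK As.
rewrite -(mulmxA (mskw eta)) mskwE cross_cross.
rewrite /sff_symbol /sym scalerA mulfV ?pnatr_eq0 // scale1r.
have distr (B C D : 'M[R]_3) (v : 'cV[R]_3) :
    (B + C - D) *m v = B *m v + C *m v - D *m v.
  by rewrite mulmxBl mulmxDl.
rewrite distr -scalemxAl (trmx_mul (PiF n *m A *m n)) trmxK !outer_mul.
rewrite -!(mulmxA (PiF n)) -(mulmxA A) !dot_PiF PiF_cross.
have -> : dot (A *m n) (cross n xi) = dot n (A *m cross n xi).
  by rewrite dot_mul As.
rewrite !PiFE; move: (cross n xi) (A *m n) (A *m cross n xi) => b a v.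
by apply/colP => i; rewrite !mxE; ring.
Qed.

(** The Codazzi equation identifies the surface rotation of the second fundamental
form with the part of the ambient curvature that mixes tangential and normal
directions.  This is its linearisation at the flat metric, the left-hand side
being built on the linearised curvature [curl((curl S)^T)] of the metric perturbed
by [S]. *)
Lemma linearized_codazzi n S x : Ckmx 2 Omega S ->
  (forall y, Omega y -> (S y)^T = S y) -> Omega x ->
  cross n (curl (fun y => (curl S y)^T) x *m n) = mrotF n (sff n S) x.
Proof.
move=> CS SS Ox.
have CS1 : Ckmx 1 Omega S by apply: Ckmx_leq CS.
rewrite mrotF_op (eq_symop oO _ Ox (fun y Oy => sff_op n CS1 Oy)).
have -> : (fun y => (curl S y)^T) = symop (fun xi A => (A *m (mskw xi)^T)^T) S.
  apply: funext => y; rewrite curl_op (lin_symop (L := @trmx R 3 3)) //.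
  by apply: linear_trmx; solve_linear.
rewrite curl_op.
rewrite (lin_symop (L := fun A => cross n (A *m n))); last by solve_linear.
apply: (second_order_symbol oO (P := fun A => A^T = A)) => //;
  try by move=> xi; solve_linear.
  move=> q r; apply: (pdmx_symmetric oO) => // y Oy.
  exact: (pdmx_symmetric oO).
move=> xi eta A As; rewrite !linearized_codazzi_symbol //.
have -> : dot xi (cross n eta) = - dot eta (cross n xi).
  by rewrite dot_cross dot_cross crossC dotN.
by rewrite scaleNr opprK addrACA addNr addr0.
Qed.

End SecondFundamentalForm.

(** * Traces of dev def u *)

Section DevDef.
Context {R : realType} {Omega : set 'cV[R]_3}.
Hypothesis oO : open Omega.
Implicit Types (n x xi eta w : 'cV[R]_3) (A : 'M[R]_3).
Implicit Types (u : 'cV[R]_3 -> 'cV[R]_3).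

Lemma tr1_cott_devdef n u x : Ckmx 1 Omega u -> Omega x ->
  tr1_cott n (devdef u) x
  = 2^-1 *: defF n (fun y => cross (u y) n) x
    - 2^-1 *: sym (vcurlF n (fun y => PiF n *m u y) x).
Proof.
move=> Cu Ox; rewrite /tr1_cott /devdef def_op defF_op vcurlF_op.
rewrite (symop_lin oO (L := fun w => cross w n)) //; last by solve_linear.
rewrite (symop_lin oO (L := fun w => PiF n *m w)) //; last by solve_linear.
rewrite (lin_symop (L := fun A => sym (PiF n *m dev A *m mskw n)));
  last by solve_linear.
rewrite (lin_symop (L := fun A => 2^-1 *: sym A)); last by solve_linear.
rewrite (lin_symop (L := fun A => 2^-1 *: A)); last by solve_linear.
rewrite /symop -sumrB; apply: eq_bigr => q _.
move: (delta_mx q 0) (pdmx q u x) => xi w.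
(* The trace part removed by dev contributes a multiple of sym (mskw n). *)
rewrite /dev mulmxBr mulmxBl mul_mx_scalar -scalemxAl PiF_mskw sym_sub_mskw.
have -> : PiF n *m sym (w *m xi^T) *m mskw n
    = 2^-1 *: (- (PiF n *m w *m (cross n xi)^T)
               - PiF n *m xi *m (cross n w)^T).
  rewrite /sym trmx_mul trmxK -scalemxAr -scalemxAl mulmxDr mulmxDl.
  by rewrite -!mulmxA !tr_mul_mskw !mulmxN.
rewrite (crossC w).
move: (cross n xi) (cross n w) (PiF n *m xi) (PiF n *m w) => a b c d.
by apply/matrixP => i j; rewrite /sym !(mxE, sum_I1); field.
Qed.

Lemma sym_curl_symbol_dev xi A :
  sym (dev A *m (mskw xi)^T) = sym (A *m (mskw xi)^T).
Proof.
rewrite /dev mulmxBl mul_scalar_mx.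
by rewrite tr_mskw scalerN -scaleNr sym_sub_mskw.
Qed.

(** [curl] of [(grad u)^T] is [(grad curl u)^T] while [curl] of [grad u] vanishes,
and [curl] of a scalar multiple of the identity is skew. *)
Lemma symcurl_devdef u x : Ckmx 2 Omega u -> Omega x ->
  symcurl (devdef u) x = 2^-1 *: def (vcurl u) x.
Proof.
move=> Cu Ox.
rewrite symcurl_op (funext (devdef_op u)) def_op (funext (vcurl_op u)).
rewrite (lin_symop (L := fun A => 2^-1 *: A)); last by solve_linear.
apply: (second_order_symbol oO (P := fun=> True)) => //;
  try by move=> xi; solve_linear.
move=> xi eta w _; rewrite !sym_curl_symbol_dev.
have E (a b : 'cV[R]_3) : sym (w *m b^T) *m (mskw a)^T
    = 2^-1 *: (w *m (cross a b)^T + b *m (cross a w)^T).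
  rewrite /sym trmx_mul trmxK -scalemxAl mulmxDl.
  by rewrite -!mulmxA !tr_mul_tr_mskw.
rewrite !E (crossC eta xi).
move: (cross xi eta) (cross xi w) (cross eta w) => a b c.
by apply/matrixP => i j; rewrite /sym !(mxE, sum_I1); field.
Qed.

Lemma divF_cross n u x : Ckmx 1 Omega u -> Omega x ->
  divF n (fun y => cross (u y) n) x = dot (vcurl u x) n.
Proof.
move=> Cu Ox; rewrite divF_op vcurl_op.
rewrite (symop_lin oO (L := fun w => cross w n)) //; last by solve_linear.
rewrite (lin_symop (W' := R^o) (L := fun w => dot w n)); last by solve_linear.
apply: eq_symbol => xi w.
by rewrite dot_PiF crossC mulmxN PiF_cross -crossC dot_cross dot_cross dotC.
Qed.

Lemma tr3_cott_devdef n u x : Ckmx 3 Omega u -> Omega x ->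
  tr3_cott n (devdef u) x
  = 2^-1 *: hessF n (divF n (fun y => cross (u y) n)) x.
Proof.
move=> Cu Ox; rewrite -[LHS]/(sff n (symcurl (devdef u)) x).
have Cu2 : Ckmx 2 Omega u by apply: Ckmx_leq Cu.
have Cu1 : Ckmx 1 Omega u by apply: Ckmx_leq Cu.
have Cc : Ckmx 2 Omega (vcurl u) by exact: (Ckmx_vcurl oO).
have Cd : Ckmx 1 Omega (def (vcurl u)) by exact: (Ckmx_def oO).
have lh : linear (fun A : 'M[R]_3 => 2^-1 *: A) by solve_linear.
have Cs : Ckmx 1 Omega (symcurl (devdef u)).
  apply: (eq_Ckmx oO) (Ckmx_lin oO lh Cd) => y Oy.
  by rewrite (symcurl_devdef Cu2 Oy).
rewrite (sff_op oO n Cs Ox).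
rewrite (eq_symop oO _ Ox (fun y Oy => symcurl_devdef Cu2 Oy)).
rewrite (symop_lin oO (sff_symbol n) lh Cd Ox).
rewrite (eq_hessF oO n Ox (fun y Oy => divF_cross n Cu1 Oy)).
rewrite -(sff_def oO n Cc Ox) (sff_op oO n Cd Ox).
rewrite (lin_symop (L := fun A => 2^-1 *: A)) //; apply: eq_symbol => xi A.
exact: linearZ_fun (linear_sff_symbol n xi).
Qed.

(** On [f I] the operator [sff] is [- (d_n f) Pi] because [Pi n = 0] for a unit
normal, and [Pi x n = mskw n] is skew. *)
Lemma sff_mskw_dev n xi A : dot n n = 1 ->
  sym (sff_symbol n xi (dev A) *m mskw n) = sym (sff_symbol n xi A *m mskw n).
Proof.
move=> n1.
have Pn : PiF n *m n = 0 by rewrite PiFE n1 scale1r subrr.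
have s1 : sff_symbol n xi 1%:M *m mskw n = - dot n xi *: mskw n.
  rewrite /sff_symbol mulmx1 Pn mul0mx /sym trmx0 addr0 !scaler0 add0r.
  by rewrite mulNmx -scalemxAl -mulmxA !PiF_mskw scaleNr.
have -> : dev A = - (3^-1 * \tr A) *: 1%:M + A.
  by rewrite /dev scaleNr scalemx1 addrC.
rewrite linear_sff_symbol mulmxDl -scalemxAl s1 scalerA addrC.
by rewrite -[_ *: mskw n]opprK -scaleNr sym_sub_mskw.
Qed.

Lemma tr2_cott_devdef n u x : dot n n = 1 -> Ckmx 2 Omega u -> Omega x ->
  tr2_cott n (devdef u) x = - defF n (curlF n (fun y => dot (u y) n)) x.
Proof.
move=> n1 Cu Ox; rewrite -[LHS]/(sym (sff n (devdef u) x *m mskw n)).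
have Cu1 : Ckmx 1 Omega u by apply: Ckmx_leq Cu.
have Cd : Ckmx 1 Omega (def u) by exact: (Ckmx_def oO).
have ld : linear (fun A : 'M[R]_3 => dev A) by solve_linear.
have lm : linear (fun A : 'M[R]_3 => sym (A *m mskw n)) by solve_linear.
have -> : sym (sff n (devdef u) x *m mskw n) = sym (sff n (def u) x *m mskw n).
  rewrite (sff_op oO n (Ckmx_lin oO ld Cd) Ox) (sff_op oO n Cd Ox).
  rewrite (symop_lin oO (sff_symbol n) ld Cd Ox).
  rewrite [LHS](lin_symop _ _ _ lm) [RHS](lin_symop _ _ _ lm).
  by apply: eq_symbol => xi A; exact: sff_mskw_dev.
rewrite (sff_def oO n Cu Ox) hessF_op defF_op.
rewrite (eq_symop oO _ Ox (fun y Oy => gradF_dot oO n Cu1 Oy)).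
rewrite (eq_symop oO _ Ox (fun y Oy => curlF_dot oO n Cu1 Oy)).
rewrite (lin_symop (L := fun A => sym (A *m mskw n))) //.
rewrite (lin_symop (L := fun A => - A)); last by solve_linear.
apply: (second_order_symbol oO (P := fun=> True)) => //;
  try by move=> xi; solve_linear.
have E xi eta w : sym (PiF n *m xi *m (dot w n *: (PiF n *m eta))^T *m mskw n)
    = - sym (dot w n *: cross n eta *m (PiF n *m xi)^T).
  rewrite -mulmxA linearZ /= -scalemxAl tr_mul_mskw cross_PiF.
  rewrite -scalemxAr mulmxN -scalemxAl.
  move: (PiF n *m xi) (cross n eta) => a b.
  by apply/matrixP => i j; rewrite /sym !(mxE, sum_I1); field.
by move=> xi eta w _; rewrite !E.
Qed.

End DevDef.

(** * Traces of cott sigma *)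

Section Cott.
Context {R : realType} {Omega : set 'cV[R]_3}.
Hypothesis oO : open Omega.
Implicit Types (n x xi eta : 'cV[R]_3) (A : 'M[R]_3).
Implicit Types (U S sigma K : 'cV[R]_3 -> 'M[R]_3).

Lemma mxtrace_curl_symmetric S x : (forall y, Omega y -> (S y)^T = S y) ->
  Omega x -> \tr (curl S x) = 0.
Proof.
move=> SS Ox; rewrite curl_op.
rewrite (lin_symop (W' := R^o) (L := @mxtrace R 3)); last first.
  by apply: linear_mxtrace; solve_linear.
by apply: big1 => q _; apply: mxtrace_sym_mskw; exact: (pdmx_symmetric oO).
Qed.

Lemma cott_symmetric sigma x : (forall y, Omega y -> (sigma y)^T = sigma y) ->
  Omega x ->
  cott sigma x = curl (Sinv \o curl (fun y => (curl sigma y)^T)) x.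
Proof.
move=> sS Ox; apply: (eq_curl oO Ox) => y Oy /=.
congr Sinv; apply: (eq_curl oO Oy) => z Oz /=.
by rewrite /Sinv mxtrace_curl_symmetric // mulr0 -scalemx1 scale0r subr0.
Qed.

(** Write [A = sym A + mskw b].  The symmetric part contributes no trace.  On the
skew part [curl] followed by [Sinv] is the gradient of [b], because
[mskw eta (mskw b)] is [b eta^T] up to a multiple of the identity, the one that
[Sinv] removes. *)
Lemma Sinv_curl_tr_symbol eta A :
  Sinv (A^T *m (mskw eta)^T)
  = (sym A *m (mskw eta)^T)^T + axial A *m eta^T.
Proof.
have tA : \tr (A^T *m (mskw eta)^T) = - 2 * dot (axial A) eta.
  rewrite {1}(mskw_axial A) linearD /= tr_sym tr_mskw mulmxDl linearD /=.
  rewrite mxtrace_sym_mskw ?tr_sym // add0r tr_mskw mulNmx mulmxN opprK.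
  exact: tr_mskw_mskw.
rewrite /Sinv tA !trmx_mul !trmxK tr_sym {1}(mskw_axial A) mulmxDr mskw_mul_mskw.
rewrite (dotC eta) -!addrA -opprD -raddfD /=.
have -> : dot (axial A) eta + 2^-1 * (- 2 * dot (axial A) eta) = 0 by field.
by rewrite -scalemx1 scale0r subr0.
Qed.

(** By [Sinv_curl_tr_symbol] the arguments of the two outer [curl]s differ by the
gradient of [axial K], and [curl] kills gradients. *)
Lemma curl_Sinv_curl_tr K x : Ckmx 2 Omega K -> Omega x ->
  curl (Sinv \o curl (fun y => (K y)^T)) x
  = curl (fun y => (curl (fun z => sym (K z)) y)^T) x.
Proof.
move=> CK Ox.
have CK1 : Ckmx 1 Omega K by apply: Ckmx_leq CK.
have E1 y : Omega y -> (Sinv \o curl (fun y => (K y)^T)) y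
    = symop (fun xi A => Sinv (A^T *m (mskw xi)^T)) K y.
  move=> Oy; rewrite /= curl_op (symop_lin oO (L := @trmx R 3 3)) //; last first.
    by apply: linear_trmx; solve_linear.
  by rewrite (lin_symop (L := @Sinv R)) //; apply: linear_Sinv; solve_linear.
have E2 y : Omega y -> (curl (fun z => sym (K z)) y)^T
    = symop (fun xi A => (sym A *m (mskw xi)^T)^T) K y.
  move=> Oy; rewrite curl_op (symop_lin oO (L := @sym R)) //; last first.
    by apply: linear_sym; solve_linear.
  by rewrite (lin_symop (L := @trmx R 3 3)) //; apply: linear_trmx; solve_linear.
rewrite !curl_op (eq_symop oO _ Ox E1) (eq_symop oO _ Ox E2).
apply: (second_order_symbol oO (P := fun=> True)) => //;
  try by move=> xi; solve_linear.
move=> xi eta A _; rewrite !Sinv_curl_tr_symbol !mulmxDl -!mulmxA !tr_mul_tr_mskw.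
(* The gradient terms are b (xi x eta)^T, antisymmetric in xi and eta. *)
rewrite (crossC eta) linearN mulmxN /=.
by rewrite addrACA subrr addr0.
Qed.

(** [(curl U) n] is [rot_F U], and [rot_F w = - div_F(n x w)]. *)
Lemma dot_curl_mul n U x : Ckmx 1 Omega U -> Omega x ->
  dot n (curl U x *m n) = - divF n (fun y => cross n ((U y)^T *m n)) x.
Proof.
move=> CU Ox; rewrite curl_op divF_op.
rewrite (symop_lin oO (L := fun A => cross n (A^T *m n))) //; last by solve_linear.
rewrite (lin_symop (W' := R^o) (L := fun A => dot n (A *m n))); last by solve_linear.
rewrite (lin_symop (W' := R^o) (L := fun a : R^o => - a)); last by solve_linear.
apply: eq_symbol => xi A; rewrite mul_tr_mskw_mul dot_mul dot_PiF PiF_cross.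
by rewrite dot_cross dot_cross crossC dotN.
Qed.

(** [div_F div_F] does not see skew parts, and [div_F (U x n) = rot_F U]. *)
Lemma divF_mdivF_sym_mskw n U x : Ckmx 2 Omega U -> Omega x ->
  divF n (mdivF n (fun y => sym (U y *m mskw n))) x = divF n (mrotF n U) x.
Proof.
move=> CU Ox.
have CU1 : Ckmx 1 Omega U by apply: Ckmx_leq CU.
have E1 y : Omega y -> mdivF n (fun y => sym (U y *m mskw n)) y
    = symop (fun xi A => sym (A *m mskw n) *m (PiF n *m xi)) U y.
  move=> Oy; rewrite mdivF_op (symop_lin oO (L := fun A => sym (A *m mskw n))) //.
  by solve_linear.
rewrite !divF_op (eq_symop oO _ Ox E1).
rewrite (eq_symop oO _ Ox (fun y _ => mrotF_op n U y)).
apply: (second_order_symbol oO (P := fun=> True)) => //;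
  try by move=> xi; solve_linear.
move=> xi eta A _.
have E a b (B : 'M[R]_3) :
    dot a (sym B *m b) = 2^-1 * (dot a (B *m b) + dot b (B *m a)).
  rewrite (dot_mul b) (dotC (B^T *m b)) /sym -scalemxAl mulmxDl.
  by rewrite !dot_entry -scalemxAr mulmxDr !mxE.
rewrite !E -!mulmxA !mskwE !cross_PiF.
by field.
Qed.

Lemma cott_normal_normal n sigma x : Ckmx 3 Omega sigma ->
  (forall y, Omega y -> (sigma y)^T = sigma y) -> Omega x ->
  dot n (cott sigma x *m n) = - divF n (mdivF n (tr2_cott n sigma)) x.
Proof.
move=> Cs sS Ox.
have Cs2 : Ckmx 2 Omega sigma by apply: Ckmx_leq Cs.
have CX : Ckmx 1 Omega (curl (fun y => (curl sigma y)^T)).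
  apply: (Ckmx_curl oO); apply: (Ckmx_lin oO (L := @trmx R 3 3)).
    by apply: linear_trmx; solve_linear.
  exact: (Ckmx_curl oO).
have CY : Ckmx 1 Omega (Sinv \o curl (fun y => (curl sigma y)^T)).
  by apply: (Ckmx_lin oO (L := @Sinv R)) CX; apply: linear_Sinv; solve_linear.
have E : divF n (mdivF n (tr2_cott n sigma)) x
    = divF n (mrotF n (sff n sigma)) x.
  exact: (divF_mdivF_sym_mskw n (Ckmx_sff oO n Cs) Ox).
rewrite E (cott_symmetric sS Ox) (dot_curl_mul n CY Ox).
apply: (congr1 -%R).
rewrite !divF_op; apply: (eq_symop oO _ Ox) => y Oy.
(* Sinv transposes up to a multiple of the identity, and n x n = 0. *)
by rewrite -(linearized_codazzi oO n Cs2 sS Oy); exact: cross_Sinv_tr.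
Qed.

Lemma cott_tangential_normal n sigma x : Ckmx 3 Omega sigma ->
  (forall y, Omega y -> (sigma y)^T = sigma y) -> Omega x ->
  cross n (cott sigma x *m n) = mrotF n (tr3_cott n sigma) x.
Proof.
move=> Cs sS Ox.
have CK : Ckmx 2 Omega (curl sigma) by exact: (Ckmx_curl oO).
have CG : Ckmx 2 Omega (symcurl sigma).
  by apply: (Ckmx_lin oO (L := @sym R)) CK; apply: linear_sym; solve_linear.
rewrite (cott_symmetric sS Ox) (curl_Sinv_curl_tr CK Ox).
exact: (linearized_codazzi oO n CG (fun y _ => tr_sym _) Ox).
Qed.

End Cott.

Theorem theorem4p1 (R : realType) (v : 'I_4 -> 'cV[R]_3) (i : 'I_4)
    (n : 'cV[R]_3) (Omega : set 'cV[R]_3)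
    (hv : tetrahedron v) (hn : unit_normal v i n)
    (hO : open Omega) (hF : face v i `<=` Omega) :
  (forall u : 'cV[R]_3 -> 'cV[R]_3, Ckmx 1 Omega u ->
     forall x, face v i x ->
       tr1_cott n (devdef u) x
       = 2^-1 *: defF n (fun y => cross (u y) n) x
         - 2^-1 *: sym (vcurlF n (fun y => PiF n *m u y) x))
  /\ (forall u : 'cV[R]_3 -> 'cV[R]_3, Ckmx 2 Omega u ->
     forall x, face v i x ->
       tr2_cott n (devdef u) x
       = - defF n (curlF n (fun y => dot (u y) n)) x)
  /\ (forall u : 'cV[R]_3 -> 'cV[R]_3, Ckmx 3 Omega u ->
     forall x, face v i x ->
       tr3_cott n (devdef u) x
       = 2^-1 *: hessF n (divF n (fun y => cross (u y) n)) x)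
  /\ (forall sigma : 'cV[R]_3 -> 'M[R]_3, Ckmx 3 Omega sigma ->
     (forall x, Omega x -> (sigma x)^T = sigma x /\ \tr (sigma x) = 0) ->
     forall x, face v i x ->
       dot n (cott sigma x *m n) = - divF n (mdivF n (tr2_cott n sigma)) x
       /\ cross n (cott sigma x *m n) = mrotF n (tr3_cott n sigma) x).
Proof.
have [n1 _] := hn.
split; first by move=> u Cu x /hF; exact: tr1_cott_devdef.
split; first by move=> u Cu x /hF; exact: tr2_cott_devdef.
split; first by move=> u Cu x /hF; exact: tr3_cott_devdef.
move=> sigma Cs hs x /hF Ox.
have sS y : Omega y -> (sigma y)^T = sigma y by move=> /hs[].
split; first exact: (cott_normal_normal hO n Cs sS Ox).
exact: (cott_tangential_normal hO n Cs sS Ox).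
Qed.
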